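(* Let $\{\tau_j\}_{j=1}^n$ be a collection in a finite dimensional Banach space $\mathcal{X}$ over $\mathbb{K}$ of dimension $d$ and let $\{f_j\}_{j=1}^n$ be a collection in $\mathcal{X}^*$. Let $n\geq d$ and $m\in\mathbb{N}$. If the operator $$S_{f,\tau}:\mathrm{Sym}^m(\mathcal{X})\ni x\mapsto S_{f,\tau}x:=\sum_{j=1}^n f_j^{\otimes m}(x)\,\tau_j^{\otimes m}\in \mathrm{Sym}^m(\mathcal{X})$$ is diagonalizable and its eigenvalues are all nonnegative, then $$\sum_{1\leq j,k\leq n}f_j(\tau_k)^m f_k(\tau_j)^m=\sum_{j=1}^n\sum_{k=1}^n f_j(\tau_k)^m f_k(\tau_j)^m\ \geq\ \frac{1}{\binom{d+m-1}{m}}\Big(\sum_{j=1}^n f_j(\tau_j)^m\Big)^2=\frac{1}{\dim(\mathrm{Sym}^m(\mathcal{X}))}\Big(\sum_{j=1}^n f_j(\tau_j)^m\Big)^2 \qquad ( * )$$ and $$\max_{1\leq j,k\leq n,\ j\neq k}|f_j(\tau_k)f_k(\tau_j)|^m\ \geq\ \frac{\frac{1}{\binom{d+m-1}{m}}\big(\sum_{j=1}^n f_j(\tau_j)^m\big)^2-\sum_{j=1}^n|f_j(\tau_j)|^{2m}}{n^2-n}=\frac{\frac{1}{\dim(\mathrm{Sym}^m(\mathcal{X}))}\big(\sum_{j=1}^n f_j(\tau_j)^m\big)^2-\sum_{j=1}^n|f_j(\tau_j)|^{2m}}{n^2-n},$$ $$\max_{1\leq j,k\leq n,\ j\neq k}|f_j(\tau_k)|^m\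 \geq\ \sqrt{\frac{\frac{1}{\binom{d+m-1}{m}}\big(\sum_{j=1}^n f_j(\tau_j)^m\big)^2-\sum_{j=1}^n|f_j(\tau_j)|^{2m}}{n^2-n}}=\sqrt{\frac{\frac{1}{\dim(\mathrm{Sym}^m(\mathcal{X}))}\big(\sum_{j=1}^n f_j(\tau_j)^m\big)^2-\sum_{j=1}^n|f_j(\tau_j)|^{2m}}{n^2-n}}.$$ Further, equality holds in $( * )$ if and only if $(\{f_j^{\otimes m}\}_{j=1}^n,\{\tau_j^{\otimes m}\}_{j=1}^n)$ is a tight ASF for $\mathrm{Sym}^m(\mathcal{X})$. In particular, if $f_j(\tau_j)=1$ for all $1\leq j\leq n$, then $$\max_{1\leq j,k\leq n,\ j\neq k}|f_j(\tau_k)f_k(\tau_j)|^m\ \geq\ \frac{n-\binom{d+m-1}{m}}{\binom{d+m-1}{m}(n-1)}=\frac{n-\dim(\mathrm{Sym}^m(\mathcal{X}))}{\dim(\mathrm{Sym}^m(\mathcal{X}))(n-1)}=\frac{1}{n-1}\left[\frac{n}{\binom{d+m-1}{m}}-1\right]$$ and $$\max_{1\leq j,k\leq n,\ j\neq k}|f_j(\tau_k)|^m\ \geq\ \sqrt{\frac{n-\binom{d+m-1}{m}}{\binom{d+m-1}{m}(n-1)}}=\sqrt{\frac{n-\dim(\mathrm{Sym}^m(\mathcal{X}))}{\dim(\mathrm{Sym}^m(\mathcal{X}))(n-1)}}=\sqrt{\frac{1}{n-1}\left[\frac{n}{\binom{d+m-1}{m}}-1\right]}.$$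
   Context: $\mathbb{K}$ is $\mathbb{R}$ or $\mathbb{C}$; $\mathcal{X}^*$ is the dual of $\mathcal{X}$. $\mathrm{Sym}^m(\mathcal{X})\subseteq\mathcal{X}^{\otimes m}$ is the Banach space of symmetric $m$-tensors, of dimension $\binom{d+m-1}{m}$. For $\tau\in\mathcal{X}$, $\tau^{\otimes m}=\tau\otimes\cdots\otimes\tau$ ($m$ factors); for $f\in\mathcal{X}^*$, $f^{\otimes m}$ is the functional determined by $f^{\otimes m}(x_1\otimes\cdots\otimes x_m)=f(x_1)\cdots f(x_m)$, restricted to $\mathrm{Sym}^m(\mathcal{X})$. An operator on a finite dimensional space is diagonalizable if the space has a basis of eigenvectors of it. For a finite dimensional Banach space $V$, vectors $\omega_1,\dots,\omega_n\in V$ and functionals $g_1,\dots,g_n\in V^*$, the pair $(\{g_j\}_{j=1}^n,\{\omega_j\}_{j=1}^n)$ is an approximate Schauder frame (ASF) for $V$ if $x\mapsto\sum_{j=1}^n g_j(x)\omega_j$ is invertible on $V$; it is a tight ASF if this operator equals $\lambda I_V$ for some nonzero scalar $\lambda$, where $I_V$ is the identity operator on $V$.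
   Formalization: The equivalence ''equality in ( * ) iff tight ASF'' is stated only for nonzero S_{f,τ}: when S_{f,τ}=0 on a nonzero space (e.g. all τ_j=0), equality holds but the pair is not a tight ASF. The bounds on maxima are stated for n≥2. *)

(* Defs.v *)
From HB Require Import structures.
From mathcomp Require Import all_boot all_order all_algebra fingroup perm.
From mathcomp Require Import all_classical all_reals topology normedtype.
From mathcomp Require Import complex.

Set Implicit Arguments.
Unset Strict Implicit.
Unset Printing Implicit Defensive.

Import Order.TTheory GRing.Theory Num.Theory.
Import numFieldNormedType.Exports.

Local Open Scope ring_scope.

Variant scalar_kind := RealScalars | ComplexScalars.

Definition scalars (R : realType) (k : scalar_kind) : numFieldType :=
  match k with
  | RealScalars => R
  | ComplexScalars => R[i]
  end.

(* Square root of a real scalar, as an element of the same field.  As with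
   Num.sqrt, the value on negative reals is 0. *)
Definition sqrt_scalar (R : realType) (k : scalar_kind) :
    scalars R k -> scalars R k :=
  match k with
  | RealScalars => fun x => Num.sqrt x
  | ComplexScalars => fun z => (Num.sqrt (complex.Re z))%:C%C
  end.

#[short(type="finBanachType")]
HB.structure Definition FinBanach (K : numFieldType) :=
  {T of CompleteNormedModule K T & Vector K T}.

Section MultilinearForms.
Variables (K : fieldType) (X : vectType K) (m : nat).
Implicit Types (x : {ffun 'I_m -> X}) (A B : {ffun 'I_m -> X} -> K^o).

Definition update x (i : 'I_m) (v : X) : {ffun 'I_m -> X} :=
  [ffun j => if j == i then v else x j].

Definition multilinear A := forall x i (a : K) (u v : X),
  A (update x i (a *: u + v)) = a * A (update x i u) + A (update x i v).

Definition multilinearb : {pred {ffun 'I_m -> X} -> K^o} :=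
  fun A => `[< multilinear A >].

Fact multilinear_submod : submod_closed multilinearb.
Proof.
split.
  by apply/asboolP => x i a u v; rewrite [LHS]/GRing.zero/= mulr0 addr0.
move=> b A B /asboolP hA /asboolP hB; apply/asboolP => x i a u v.
have E y : (b *: A + B) y = b * A y + B y by [].
by rewrite !E hA hB !mulrDr !mulrA (mulrC b a) addrACA.
Qed.

HB.instance Definition _ :=
  GRing.isSubmodClosed.Build K ({ffun 'I_m -> X} -> K^o) multilinearb
    multilinear_submod.

Record mlform := Mlform {
  mlform_fun :> {ffun 'I_m -> X} -> K^o;
  mlform_subproof : mlform_fun \in multilinearb }.

HB.instance Definition _ := [isSub for mlform_fun].
HB.instance Definition _ := [Choice of mlform by <:].
HB.instance Definition _ := [SubChoice_isSubLmodule of mlform by <:].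

Lemma mlformP (A : mlform) : multilinear A.
Proof. exact/asboolP/mlform_subproof. Qed.

Lemma mlform_ext (A B : mlform) : A =1 B -> A = B.
Proof. by move=> AB; apply: val_inj; apply/funext. Qed.

Lemma mlform_linE (a : K) (A B : mlform) x : (a *: A + B) x = a * A x + B x.
Proof. by []. Qed.

Lemma mlform_sum (I : Type) (r : seq I) (P : pred I) (v : I -> X)
    (A : mlform) x i :
  A (update x i (\sum_(j <- r | P j) v j)) =
  \sum_(j <- r | P j) A (update x i (v j)).
Proof.
have A0 : A (update x i 0) = 0.
  have := mlformP A x i (-1) 0 0.
  by rewrite scaler0 addr0 mulN1r addNr.
elim/big_rec2: _ => // j u y _ <-.
by have := mlformP A x i 1 (v j) y; rewrite scale1r mul1r.
Qed.

Lemma mlform_scale (A : mlform) x i (a : K) v :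
  A (update x i (a *: v)) = a * A (update x i v).
Proof.
have A0 : A (update x i 0) = 0.
  have := mlformP A x i (-1) 0 0.
  by rewrite scaler0 addr0 mulN1r addNr.
by have := mlformP A x i a v 0; rewrite addr0 A0 addr0.
Qed.

Let d := \dim {:X}.
Let e := vbasis {:X}.

Lemma mlform_basis_eq0 (A : mlform) :
  (forall t : {ffun 'I_m -> 'I_d}, A [ffun i => e`_(t i)] = 0) -> A = 0.
Proof.
move=> A0; apply: mlform_ext => x; rewrite [RHS]/=.
suff H k : (k <= m)%N -> forall x : {ffun 'I_m -> X},
    (forall i : 'I_m, (k <= i)%N -> exists j : 'I_d, x i = e`_j) -> A x = 0.
  by apply: (H m) => // i; rewrite leqNgt ltn_ord.
elim: k => [_ {}x xe|k IH km {}x xe].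
  have [t tE] := choice (fun i => xe i (leq0n i)).
  rewrite -(A0 [ffun i => t i]); congr (A _).
  by apply/ffunP => i; rewrite !ffunE tE.
pose i := Ordinal km.
have -> : x = update x i (x i).
  by apply/ffunP => j; rewrite ffunE; case: eqP => // ->.
rewrite (coord_vbasis (memvf (x i))) mlform_sum big1 // => j _.
rewrite mlform_scale IH ?mulr0 ?(ltnW km) // => l kl.
rewrite ffunE; case: eqP => [_|li]; first by exists j.
apply: xe; rewrite ltn_neqAle kl andbT; apply/eqP => kE.
by apply: li; apply: val_inj.
Qed.

Lemma prod_multilinear (f : 'I_m -> 'Hom(X, K^o)) :
  (fun x => \prod_i f i (x i)) \in multilinearb.
Proof.
apply/asboolP => x i a u v.
rewrite (bigD1 i) //= [X in a * X + _](bigD1 i) //=.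
rewrite [X in _ = _ + X](bigD1 i) //= !ffunE eqxx linearP mulrDl mulrA.
by congr (_ * _ * _ + _ * _); apply: eq_bigr => j /negbTE ji; rewrite !ffunE ji.
Qed.

(* (f_1, ..., f_m) |-> ((x_1, ..., x_m) |-> f_1(x_1) ... f_m(x_m)) *)
Definition prod_form (f : 'I_m -> 'Hom(X, K^o)) : mlform :=
  Mlform (prod_multilinear f).

Let basis_form (t : {ffun 'I_m -> 'I_d}) : mlform :=
  prod_form (fun i => linfun (coord e (t i) : X -> K^o)).

Let basis_formE (t t' : {ffun 'I_m -> 'I_d}) : basis_form t [ffun i => e`_(t' i)] = (t == t')%:R.
Proof.
rewrite /=; have [->|tt'] := eqVneq t t'.
  apply: big1 => i _; rewrite lfunE ffunE /= coord_free ?eqxx //.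
  exact: basis_free (vbasisP _).
have [i ti] : exists i, t i != t' i.
  apply/existsP; apply: contraNT tt'; rewrite negb_exists => /forallP h.
  by apply/eqP/ffunP => i; have := h i; rewrite negbK => /eqP.
rewrite (bigD1 i) //= lfunE ffunE /= coord_free; last first.
  exact: basis_free (vbasisP _).
by rewrite eq_sym (negbTE ti) mul0r.
Qed.

Lemma mlform_decomp (A : mlform) :
  A = \sum_(t : {ffun 'I_m -> 'I_d}) A [ffun i => e`_(t i)] *: basis_form t.
Proof.
apply/eqP; rewrite -subr_eq0; apply/eqP/mlform_basis_eq0 => t.
set B := \sum_t _; transitivity (A [ffun i => e`_(t i)] -
    B [ffun i => e`_(t i)]) => //.
suff -> : B [ffun i => e`_(t i)] = A [ffun i => e`_(t i)] by rewrite subrr.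
transitivity (\sum_(t' : {ffun 'I_m -> 'I_d})
    A [ffun i => e`_(t' i)] * (t' == t)%:R).
  rewrite /B; elim/big_rec2: _ => // t' y C _ <-.
  by rewrite mlform_linE basis_formE.
rewrite (bigD1 t) //= eqxx mulr1 big1 ?addr0 // => t' /negbTE ->.
by rewrite mulr0.
Qed.

Fact mlform_vect_iso :
  Vector.axiom #|{: {ffun 'I_m -> 'I_d}}| mlform.
Proof.
pose v2r (A : mlform) : 'rV[K]_#|{: {ffun 'I_m -> 'I_d}}| :=
  \row_k A [ffun i => e`_((enum_val k : {ffun 'I_m -> 'I_d}) i)].
pose r2v (r : 'rV[K]_#|{: {ffun 'I_m -> 'I_d}}|) : mlform :=
  \sum_k r 0 k *: basis_form (enum_val k).
have lin : linear v2r by move=> a A B; apply/rowP => k; rewrite !mxE.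
have r2vE r (t : {ffun 'I_m -> 'I_d}) : r2v r [ffun i => e`_(t i)] = r 0 (enum_rank t).
  transitivity (\sum_k r 0 k * (enum_val k == t)%:R).
    rewrite /r2v; elim/big_rec2: _ => // k y A _ <-.
    by rewrite mlform_linE basis_formE.
  rewrite (bigD1 (enum_rank t)) //= enum_rankK eqxx mulr1 big1 ?addr0 //.
  move=> k kt; rewrite (_ : _ == _ = false) ?mulr0 //.
  by apply: contraNF kt => /eqP <-; rewrite enum_valK.
have v2rK r : v2r (r2v r) = r.
  by apply/rowP => k; rewrite mxE r2vE enum_valK.
exists v2r => //; exists r2v => // A.
apply/eqP; rewrite -subr_eq0; apply/eqP/mlform_basis_eq0 => t.
transitivity (r2v (v2r A) [ffun i => e`_(t i)] - A [ffun i => e`_(t i)]).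
  by [].
by rewrite r2vE mxE enum_rankK subrr.
Qed.

HB.instance Definition _ := Lmodule_hasFinDim.Build K mlform mlform_vect_iso.

Lemma permute_multilinear (s : 'S_m) (A : mlform) :
  (fun x : {ffun 'I_m -> X} => A [ffun i => x (s i)]) \in multilinearb.
Proof.
have E x i w : [ffun j => update x i w (s j)] =
    update [ffun j => x (s j)] ((s^-1)%g i) w.
  by apply/ffunP => j; rewrite !ffunE (canF_eq (permK s)).
by apply/asboolP => x i a u v; rewrite !E mlformP.
Qed.

Definition permute_form (s : 'S_m) (A : mlform) : mlform :=
  Mlform (permute_multilinear s A).

Fact permute_form_is_linear s : linear (permute_form s).
Proof. by move=> a A B; apply: mlform_ext => x. Qed.

HB.instance Definition _ s := GRing.isSemilinear.Build K mlform mlform _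
  (permute_form s) (GRing.semilinear_linear (permute_form_is_linear s)).

End MultilinearForms.

Section TensorPowers.
Variables (K : fieldType) (m : nat) (X : vectType K).

(* X being finite dimensional, its m-th tensor power is the dual of the space
   of m-linear forms on X: x_1 (x) ... (x) x_m is the evaluation of m-linear
   forms at (x_1, ..., x_m). *)
Definition tensor_power : vectType K := 'Hom(mlform X m, K^o).

Definition eval_form (x : {ffun 'I_m -> X}) (A : mlform X m) : K^o := A x.

Fact eval_form_is_linear x : linear (eval_form x).
Proof. by []. Qed.

HB.instance Definition _ x :=
  GRing.isSemilinear.Build K (mlform X m) K^o _ (eval_form x)
    (GRing.semilinear_linear (eval_form_is_linear x)).

Definition pure_tensor (x : {ffun 'I_m -> X}) : tensor_power :=
  linfun (eval_form x).

Lemma pure_tensorE x (A : mlform X m) : pure_tensor x A = A x.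
Proof. exact: lfunE. Qed.

Lemma tensor_pure_sum (u : tensor_power) :
  exists (I : finType) (c : I -> K) (x : I -> {ffun 'I_m -> X}),
    u = \sum_i c i *: pure_tensor (x i).
Proof.
pose d := \dim {:X}; pose e := vbasis {:X}.
exists {ffun 'I_m -> 'I_d},
  (fun t : {ffun 'I_m -> 'I_d} =>
     u (prod_form (fun i => linfun (coord e (t i) : X -> K^o)))),
  (fun t : {ffun 'I_m -> 'I_d} => [ffun i => e`_(t i)]).
apply/lfunP => A; rewrite {1}(mlform_decomp A) linear_sum sum_lfunE /=.
apply: eq_bigr => t _.
by rewrite linearZ scale_lfunE pure_tensorE /= [LHS]mulrC.
Qed.

Definition precomp_permute (s : 'S_m) (u : tensor_power) : tensor_power :=
  (u \o linfun (@permute_form K X m s))%VF.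

Fact precomp_permute_is_linear s : linear (precomp_permute s).
Proof.
by move=> a u v; rewrite /precomp_permute comp_lfunDl comp_lfunZl.
Qed.

HB.instance Definition _ s :=
  GRing.isSemilinear.Build K tensor_power tensor_power _ (precomp_permute s)
    (GRing.semilinear_linear (precomp_permute_is_linear s)).

(* The action of s on tensors:
   x_0 (x) ... (x) x_(m-1) |-> x_(s 0) (x) ... (x) x_(s (m-1)). *)
Definition permute_tensor (s : 'S_m) : 'End(tensor_power) :=
  linfun (precomp_permute s).

Lemma permute_tensorE s (u : tensor_power) (A : mlform X m) :
  permute_tensor s u A = u (permute_form s A).
Proof. by rewrite lfunE /= comp_lfunE lfunE. Qed.

Lemma permute_pure s x :
  permute_tensor s (pure_tensor x) = pure_tensor [ffun i => x (s i)].
Proof. by apply/lfunP => A; rewrite permute_tensorE !pure_tensorE. Qed.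

Definition symmetric_tensors : {vspace tensor_power} :=
  (\bigcap_(s : 'S_m) fixedSpace (permute_tensor s))%VS.

Lemma symmetric_tensorsP (u : tensor_power) :
  reflect (forall s, permute_tensor s u = u) (u \in symmetric_tensors).
Proof.
rewrite memvE; apply: (iffP subv_bigcapP) => [h s|h s _].
  by apply/fixedSpaceP; rewrite memvE; apply: h.
by rewrite -memvE; apply/fixedSpaceP.
Qed.

Definition SymPow : vectType K := subvs_of symmetric_tensors.

Lemma tensor_pow_sym (v : X) : pure_tensor [ffun=> v] \in symmetric_tensors.
Proof.
apply/symmetric_tensorsP => s; rewrite permute_pure; congr pure_tensor.
by apply/ffunP => i; rewrite !ffunE.
Qed.

Definition vector_pow (v : X) : SymPow := Subvs (tensor_pow_sym v).

Definition eval_prod (f : 'Hom(X, K^o)) (u : SymPow) : K^o :=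
  vsval u (prod_form (fun _ : 'I_m => f)).

Fact eval_prod_is_linear f : linear (eval_prod f).
Proof.
by move=> a u v; rewrite /eval_prod linearP add_lfunE scale_lfunE.
Qed.

HB.instance Definition _ f :=
  GRing.isSemilinear.Build K SymPow K^o _ (eval_prod f)
    (GRing.semilinear_linear (eval_prod_is_linear f)).

(* Since x_1 (x) ... (x) x_m is evaluation at (x_1, ..., x_m), evaluating
   tensors at the form (x_1, ..., x_m) |-> f(x_1) ... f(x_m) is the functional
   with x_1 (x) ... (x) x_m |-> f(x_1) ... f(x_m). *)
Definition functional_pow (f : 'Hom(X, K^o)) : 'Hom(SymPow, K^o) :=
  linfun (eval_prod f).

Lemma functional_powE f (u : SymPow) :
  functional_pow f u = vsval u (prod_form (fun _ : 'I_m => f)).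
Proof. exact: lfunE. Qed.

End TensorPowers.

Section Frames.
Variables (K : fieldType) (V : vectType K).

Section Operator.
Variables (n : nat) (g : 'I_n -> 'Hom(V, K^o)) (w : 'I_n -> V).

Definition frame_sum (x : V) : V := \sum_j g j x *: w j.

Fact frame_sum_is_linear : linear frame_sum.
Proof.
move=> a x y; rewrite /frame_sum scaler_sumr -big_split /=.
by apply: eq_bigr => j _; rewrite linearP scalerDl scalerA.
Qed.

HB.instance Definition _ := GRing.isSemilinear.Build K V V _ frame_sum
  (GRing.semilinear_linear frame_sum_is_linear).

Definition frame_operator : 'End(V) := linfun frame_sum.

Lemma frame_operatorE x : frame_operator x = \sum_j g j x *: w j.
Proof. exact: lfunE. Qed.

Definition ASF := bijective frame_operator.

Definition tight_ASF :=
  ASF /\ exists2 lambda : K, lambda != 0 & frame_operator = lambda *: \1%VF.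

End Operator.

Definition diagonalizable_endo (T : 'End(V)) := exists2 b : seq V,
  basis_of fullv b & forall v, v \in b -> exists a : K, T v = a *: v.

End Frames.

(* Main.v *)
(* The symmetric m-tensors are the invariants of S_m, so such a tensor is
   determined by its coordinates on the sorted m-tuples of basis indices, and
   these are arbitrary: this gives the dimension C(d+m-1, m).

   If the frame operator S = sum_j g_j w_j has an eigenbasis with eigenvalues
   a_i, then reading off the coordinates of S b_i and S^2 b_i gives
   sum_j g_j(w_j) = sum_i a_i and sum_(j,k) g_j(w_k) g_k(w_j) = sum_i a_i^2.
   Hence energy - trace^2 / D is the sum of the squared deviations of the a_i
   from their mean: it is nonnegative, and it vanishes iff S is scalar.  The
   bounds on the maxima follow by bounding the n^2 - n off-diagonal terms. *)
Require Import Defs.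
From HB Require Import structures.
From mathcomp Require Import all_boot all_order all_algebra fingroup perm.
From mathcomp Require Import all_classical all_reals topology normedtype.
From mathcomp Require Import complex ring.

Set Implicit Arguments.
Unset Strict Implicit.
Unset Printing Implicit Defensive.

Import Order.TTheory GRing.Theory Num.Theory.
Import numFieldNormedType.Exports.

Local Open Scope ring_scope.

(** * Sorted tuples as orbit representatives of index functions *)

Section SortFun.
Variables (m d : nat).

Let sorted_tuple := {t : m.-tuple 'I_d | sorted leq (map val t)}.

Lemma card_sorted_ord_tuples : #|{: sorted_tuple}| = 'C((d + m - 1)%N, m).
Proof.
rewrite /sorted_tuple card_sig; case: d => [|d'].
  (* For [d = 0], truncated subtraction makes the binomial 1 when [m = 0], counting the empty tuple,
     and 0 otherwise. *)
  case: m => [|m'].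
    rewrite bin0 -(expn0 #|'I_0|) -card_tuple.
    by apply: eq_card => t; rewrite tuple0.
  by rewrite bin_small ?subn1 //; apply: eq_card0 => t; case: (thead t).
by rewrite addSn subn1 /= addnC -card_sorted_tuples cardsE.
Qed.

Let le_ord : rel 'I_d := relpre val leq.

Fact sort_fun_sorted (t : {ffun 'I_m -> 'I_d}) :
  sorted leq (map val (sort_tuple le_ord [tuple t i | i < m])).
Proof.
by rewrite sorted_map; apply: sort_sorted => i j; apply: leq_total.
Qed.

(** Normal form under permutation of the arguments: two index functions have the same image exactly
    when they lie in one ['S_m]-orbit. *)
Definition sort_fun (t : {ffun 'I_m -> 'I_d}) : sorted_tuple :=
  Sub (sort_tuple le_ord [tuple t i | i < m]) (sort_fun_sorted t).

Lemma perm_sort_fun (t : {ffun 'I_m -> 'I_d}) :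
  exists s : 'S_m, t = [ffun i => tnth (val (sort_fun t)) (s i)].
Proof.
have /tuple_permP[s sE] :
    perm_eq [tuple t i | i < m] (val (sort_fun t)).
  by rewrite perm_sym perm_sort.
exists s; apply/ffunP => i; rewrite ffunE.
by have := congr1 (fun u => tnth u i) (val_inj sE); rewrite !tnth_mktuple.
Qed.

Let le_ord_trans : transitive le_ord.
Proof. by move=> i j k; apply: leq_trans. Qed.

Let le_ord_anti : antisymmetric le_ord.
Proof. by move=> i j /anti_leq /val_inj. Qed.

Lemma sort_fun_perm (t : {ffun 'I_m -> 'I_d}) (s : 'S_m) :
  sort_fun [ffun i => t (s i)] = sort_fun t.
Proof.
apply/val_inj/val_inj => /=; apply/perm_sortP => //.
  by move=> i j; apply: leq_total.
apply/(tuple_permP (t := [tuple t i | i < m])); exists s.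
by apply: eq_map => i; rewrite tnth_mktuple ffunE.
Qed.

Lemma sort_fun_tnth (t : sorted_tuple) :
  sort_fun [ffun i => tnth (val t) i] = t.
Proof.
apply/val_inj/val_inj => /=.
under eq_map do rewrite ffunE.
rewrite map_tnth_enum.
by apply: sorted_sort => //; rewrite -sorted_map; apply: (valP t).
Qed.

End SortFun.

(** * The dimension of the symmetric power *)

Section DimSymPow.
Variables (K : fieldType) (X : vectType K) (m : nat).

Let d := \dim {:X}.
Let e := vbasis {:X}.

(** These forms are dual to the tensors of basis vectors, so evaluating a tensor at them reads off
    its coordinates. *)
Definition dual_basis_form (t : 'I_m -> 'I_d) : mlform X m :=
  prod_form (fun i => linfun (coord e (t i) : X -> K^o)).

Lemma dual_basis_formE (t t' : {ffun 'I_m -> 'I_d}) :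
  dual_basis_form t [ffun i => e`_(t' i)] = (t == t')%:R.
Proof.
have eF : free e by exact: basis_free (vbasisP _).
rewrite /=; have [->|tt'] := eqVneq t t'.
  by apply: big1 => i _; rewrite lfunE ffunE /= coord_free ?eqxx.
have [i ti] : exists i, t i != t' i.
  apply/existsP; apply: contraNT tt'; rewrite negb_exists => /forallP h.
  by apply/eqP/ffunP => i; have := h i; rewrite negbK => /eqP.
rewrite (bigD1 i) //= lfunE ffunE /= coord_free //.
by rewrite eq_sym (negbTE ti) mul0r.
Qed.

(** Invariance of [u] allows applying [permute_form s] to the form; reindexing the product by [s]
    then undoes the permutation of [t]. *)
Lemma symmetric_tensor_dual_basis_form (u : SymPow m X)
    (t : {ffun 'I_m -> 'I_d}) (s : 'S_m) :
  vsval u (dual_basis_form [ffun i => t (s i)]) = vsval u (dual_basis_form t).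
Proof.
have /symmetric_tensorsP/(_ s) uE := subvsP u.
rewrite -[in LHS]uE permute_tensorE; apply: (congr1 (vsval u)).
apply: mlform_ext => x /=.
rewrite [RHS](reindex_inj (@perm_inj _ s)).
by apply: eq_bigr => i _; rewrite !ffunE.
Qed.

Lemma tensor_eq0 (u : tensor_power m X) :
  (forall t : {ffun 'I_m -> 'I_d}, u (dual_basis_form t) = 0) -> u = 0.
Proof.
move=> u0; apply/lfunP => A; rewrite lfunE (mlform_decomp A) linear_sum /=.
by apply: big1 => t _; rewrite linearZ /= [u _](u0 t) scaler0.
Qed.

Lemma dim_SymPow : \dim {: SymPow m X} = 'C((d + m - 1)%N, m).
Proof.
rewrite -card_sorted_ord_tuples.
pose J : finType := {t : m.-tuple 'I_d | sorted leq (map val t)}.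
rewrite -/J.
pose coords (u : SymPow m X) : 'rV[K]_#|{: J}| :=
  \row_k vsval u (dual_basis_form
                    [ffun i => tnth (val (enum_val k : J)) i]).
have coords_lin : linear coords.
  move=> a u v; apply/rowP => k.
  by rewrite !mxE linearP add_lfunE scale_lfunE.
pose coordsL := GRing.isSemilinear.Build K _ _ _ coords
  (GRing.semilinear_linear coords_lin).
pose coordsH : {linear SymPow m X -> 'rV[K]_#|{: J}|} :=
  HB.pack coords coordsL.
have coordsE u : linfun coordsH u = coords u by rewrite lfunE.
have ker0 : lker (linfun coordsH) == 0%VS.
  rewrite -subv0; apply/subvP => u; rewrite memv_ker memv0 coordsE => /eqP u0.
  apply/eqP/val_inj/tensor_eq0 => t.
  (* The coordinate at [t] equals the one at its sorted rearrangement, which is an entry of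
     [coords u]. *)
  have [s tE] := perm_sort_fun t.
  rewrite {1}tE.
  have := symmetric_tensor_dual_basis_form u
    [ffun i => tnth (val (sort_fun t)) i] s.
  under eq_ffun do rewrite ffunE.
  move=> ->.
  by have /rowP/(_ (enum_rank (sort_fun t))) := u0; rewrite !mxE enum_rankK.
have imT : limg (linfun coordsH) = fullv.
  apply/eqP; rewrite eqEsubv subvf; apply/subvP => c _.
  (* The preimage of [c] repeats each entry along a whole orbit; it is symmetric because [sort_fun]
     is constant on orbits. *)
  pose w : tensor_power m X := \sum_(t : {ffun 'I_m -> 'I_d})
    c 0 (enum_rank (sort_fun t)) *: pure_tensor [ffun i => e`_(t i)].
  have wP : w \in symmetric_tensors m X.
    apply/symmetric_tensorsP => s; rewrite linear_sum /=.
    have inj_s : injective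
        (fun t : {ffun 'I_m -> 'I_d} => [ffun i => t (s i)]).
      move=> t t' /ffunP tt'; apply/ffunP => i.
      by have := tt' (s^-1%g i); rewrite !ffunE permKV.
    rewrite [RHS](reindex_inj inj_s); apply: eq_bigr => t _ /=.
    rewrite linearZ /= permute_pure sort_fun_perm; congr (_ *: pure_tensor _).
    by apply/ffunP => i; rewrite !ffunE.
  apply/memv_imgP; exists (Subvs wP); first exact: memvf.
  rewrite coordsE; apply/rowP => k; rewrite mxE /= /w sum_lfunE.
  set t := finfun _.
  (* Duality keeps only the term at [t], which is already sorted, so its coefficient is entry [k] of
     [c]. *)
  rewrite (bigD1 t) //= big1 ?addr0 => [|t' t't].
    rewrite scale_lfunE pure_tensorE dual_basis_formE eqxx sort_fun_tnth.
    by rewrite enum_valK [RHS]mulr1.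
  rewrite scale_lfunE pure_tensorE dual_basis_formE eq_sym (negbTE t't).
  by rewrite scaler0.
have := limg_dim_eq (f := linfun coordsH) (U := fullv).
by rewrite (eqP ker0) capv0 imT dimvf dim_matrix mul1r => ->.
Qed.

End DimSymPow.

(** * Variance, maxima and square roots over real or complex scalars *)

Lemma sum_sqr_mean (K : numFieldType) (I : finType) (a : I -> K) :
  \sum_i (a i - #|I|%:R^-1 * \sum_j a j) ^+ 2 =
  \sum_i a i ^+ 2 - #|I|%:R^-1 * (\sum_i a i) ^+ 2.
Proof.
(* For empty [I] the inverse of 0 is 0 and every sum is empty. *)
have [I0|I_neq0] := eqVneq #|I| 0%N.
  rewrite I0 invr0 !mul0r !big1 ?subr0 // => i _;
  by have := fintype0 i; rewrite I0 => /(_ erefl).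
have N0 : #|I|%:R != 0 :> K by rewrite pnatr_eq0.
set t := \sum_j a j; set mu := _ * t.
under eq_bigr do rewrite sqrrB.
rewrite big_split sumrB /= sumrMnl -mulr_suml -/t sumr_const.
rewrite -[_ *+ #|_|]mulr_natr -[_ *+ 2]mulr_natr /mu; field.
exact: N0.
Qed.

Section BigMax.
Variables (K : numDomainType) (I : eqType) (P : pred I) (F : I -> K).
Hypothesis F_ge0 : forall i, P i -> 0 <= F i.

Lemma bigmax_ge0 (r : seq I) : 0 <= \big[Num.max/0]_(i <- r | P i) F i.
Proof.
elim/big_ind: _ => // x y x0 y0.
by rewrite comparable_le_max ?x0 // real_comparable ?ger0_real.
Qed.

(** The order of [K] may be partial, as on the complex numbers; nonnegative elements are real, hence
    comparable, so [Num.max] behaves as a maximum on them. *)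
Lemma le_bigmax_nneg (r : seq I) (i : I) :
  i \in r -> P i -> F i <= \big[Num.max/0]_(j <- r | P j) F j.
Proof.
elim: r => // j r IH; rewrite inE big_cons => /predU1P[<-|ir] Pi.
  rewrite Pi comparable_le_max ?lexx // real_comparable ?ger0_real ?F_ge0 //.
  exact: bigmax_ge0.
case: ifP => [Pj|_]; last exact: IH.
rewrite comparable_le_max ?IH ?orbT // real_comparable ?ger0_real ?F_ge0 //.
exact: bigmax_ge0.
Qed.

End BigMax.

Lemma sqrt_scalar_le (R : realType) (k : scalar_kind) (x w : scalars R k) :
  x <= w ^+ 2 -> 0 <= w -> sqrt_scalar x <= w.
Proof.
case: k x w => /= x w.
  by move=> xw w0; rewrite -[w]ger0_norm // -sqrtr_sqr ler_wsqrtr.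
(* Here [0 <= w] kills the imaginary part, and comparing real parts in [x <= w ^+ 2] reduces to the
   real case. *)
case: w => w v; rewrite [0 <= _]lecE /= => xw /andP[/eqP v0 w0].
subst v.
rewrite lecE /= eqxx /=.
move: xw; rewrite lecE => /andP[_] /=.
rewrite !mulr0 subr0 -expr2 => xw.
by rewrite -[w]ger0_norm // -sqrtr_sqr ler_wsqrtr.
Qed.

(** * Trace and energy of a frame operator through its eigenvalues *)

Section FrameEnergy.
Variables (K : numFieldType) (V : vectType K) (n : nat).
Variables (g : 'I_n -> 'Hom(V, K^o)) (w : 'I_n -> V).

Let S := frame_operator g w.
Let D : nat := \dim {:V}.

Lemma diagonalizable_eigenbasis (T : 'End(V)) : diagonalizable_endo T ->
  exists (b : D.-tuple V) (a : 'I_D -> K),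
    basis_of fullv b /\ forall i : 'I_D, T b`_i = a i *: b`_i.
Proof.
case=> b bB bE.
have sb : size b == D by rewrite eq_sym -(size_basis (X := in_tuple b) bB).
have aP (i : 'I_D) : exists a : K, T b`_i = a *: b`_i.
  by apply/bE/mem_nth; rewrite (eqP sb).
have [a aE] := choice aP.
by exists (Tuple sb), a.
Qed.

Section EigenBasis.
Variables (b : D.-tuple V) (a : 'I_D -> K).
Hypothesis b_basis : basis_of fullv b.
Hypothesis Sb : forall i : 'I_D, S b`_i = a i *: b`_i.

Let b_coord (v : V) : v = \sum_i coord b i v *: b`_i.
Proof. exact: coord_basis b_basis (memvf v). Qed.

Let b_free : free b := basis_free b_basis.

Let coordb (i : 'I_D) : coord b i b`_i = 1.
Proof. by rewrite coord_free // eqxx. Qed.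

(** Both sides are the trace of [S]: after exchanging sums, the coordinates of [w j] reassemble
    [w j] inside [g j]. *)
Lemma frame_trace : \sum_j g j (w j) = \sum_i a i.
Proof.
under [RHS]eq_bigr => i _.
  have -> : a i = coord b i (S b`_i) by rewrite Sb linearZ /= coordb mulr1.
  rewrite frame_operatorE linear_sum /=.
  under eq_bigr do rewrite linearZ /=.
  over.
rewrite exchange_big /=; apply: eq_bigr => j _.
rewrite {1}(b_coord (w j)) linear_sum /=; apply: eq_bigr => i _.
by rewrite linearZ /= mulrC.
Qed.

Lemma frame_trace_sqr :
  \sum_j \sum_k g j (w k) * g k (w j) = \sum_i a i ^+ 2.
Proof.
under [RHS]eq_bigr => i _.
  have -> : a i ^+ 2 = coord b i (S (S b`_i)).
    by rewrite Sb linearZ /= Sb scalerA linearZ /= coordb mulr1 expr2.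
  rewrite [S b`_i]frame_operatorE !linear_sum /=.
  under eq_bigr do rewrite !linearZ /=.
  over.
rewrite [RHS]exchange_big /=; apply: eq_bigr => j _.
(* This is the [j]-th contribution to the trace of the square of [S], obtained by expanding
   [S (w j)] either in the frame or in the eigenbasis. *)
transitivity (g j (S (w j))).
  rewrite frame_operatorE linear_sum /=; apply: eq_bigr => k _.
  by rewrite linearZ /= mulrC.
rewrite {1}(b_coord (S (w j))) linear_sum /=; apply: eq_bigr => i _.
by rewrite linearZ /= mulrC.
Qed.

Lemma eigenbasis_leigenvalue i : passmx.leigenvalue S (a i).
Proof.
apply/negP => /eqP E0.
have : b`_i \in passmx.leigenspace S (a i).
  rewrite memv_ker add_lfunE opp_lfunE scale_lfunE id_lfunE Sb.
  by rewrite subrr.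
rewrite E0 memv0; apply/negP; apply: contraTN (oner_neq0 K) => /eqP b0.
by rewrite negbK -(coordb i) b0 linear0.
Qed.

Lemma eigenbasis_scalar (l : K) : (forall i, a i = l) <-> S = l *: \1%VF.
Proof.
split=> [al|Sl i].
  apply/lfunP => v; rewrite (b_coord v) !linear_sum; apply: eq_bigr => i _.
  by rewrite !linearZ /= Sb al scale_lfunE id_lfunE.
have := congr1 (coord b i) (Sb i).
by rewrite Sl scale_lfunE id_lfunE !linearZ /= coordb !mulr1.
Qed.

End EigenBasis.

Hypothesis S_diag : diagonalizable_endo S.
Hypothesis S_ge0 : forall a : K, passmx.leigenvalue S a -> 0 <= a.

Let trace := \sum_j g j (w j).
Let energy := \sum_j \sum_k g j (w k) * g k (w j).

(** The sign of the trace is recorded because a complex square need not be nonnegative; it later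
    makes the lower bound on the energy nonnegative. *)
Lemma frame_energy_ge : 0 <= trace /\ D%:R^-1 * trace ^+ 2 <= energy.
Proof.
have [b [a [b_basis Sb]]] := diagonalizable_eigenbasis S_diag.
rewrite /trace /energy (frame_trace b_basis Sb) (frame_trace_sqr b_basis Sb).
(* Realness of the eigenvalues is what makes their squared deviations nonnegative. *)
have a_real i : a i \is Num.real.
  exact/ger0_real/S_ge0/(eigenbasis_leigenvalue b_basis Sb).
split.
  apply: sumr_ge0 => i _.
  exact/S_ge0/(eigenbasis_leigenvalue b_basis Sb).
rewrite -subr_ge0 -[in D%:R](card_ord D) -sum_sqr_mean; apply: sumr_ge0 => i _.
apply: real_exprn_even_ge0 => //; apply: realB => //; apply: realM.
  by rewrite realV realn.
exact: sum_real.
Qed.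

(** On a nonzero space, [S = 0] would give equality [0 = 0] although a tight ASF requires a nonzero
    scalar. *)
Lemma frame_energy_tight : S != 0 ->
  energy = D%:R^-1 * trace ^+ 2 <-> tight_ASF g w.
Proof.
move=> S0.
have [b [a [b_basis Sb]]] := diagonalizable_eigenbasis S_diag.
rewrite /trace /energy (frame_trace b_basis Sb) (frame_trace_sqr b_basis Sb).
have a_real i : a i \is Num.real.
  exact/ger0_real/S_ge0/(eigenbasis_leigenvalue b_basis Sb).
split=> [E|[_ [l l0 /(eigenbasis_scalar b_basis Sb) al]]]; last first.
  have [D0|D_neq0] := eqVneq D 0%N.
    have no_ord (i : 'I_D) : False by have := ltn_ord i; rewrite {2}D0.
    by rewrite !big1 ?expr0n ?mulr0 // => i; case: (no_ord i).
  have {}D_neq0 : D%:R != 0 :> K by rewrite pnatr_eq0.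
  under eq_bigr do rewrite al.
  under [in RHS]eq_bigr do rewrite al.
  rewrite !sumr_const card_ord -[_ *+ D]mulr_natr -[l *+ D]mulr_natr; field.
  exact: D_neq0.
set mu := D%:R^-1 * \sum_i a i.
have a_mu i : a i = mu.
  have mu_real : mu \is Num.real.
    by apply: realM; [rewrite realV realn|exact: sum_real].
  (* Equality makes the variance vanish, and a zero sum of nonnegative terms has only zero terms. *)
  have /eqP : \sum_i (a i - mu) ^+ 2 = 0.
    by rewrite /mu -[in D%:R](card_ord D) sum_sqr_mean E card_ord subrr.
  rewrite psumr_eq0 => [/allP/(_ i)|j _]; last first.
    by apply: real_exprn_even_ge0 => //; apply: realB.
  by rewrite mem_index_enum sqrf_eq0 subr_eq0 => /(_ isT)/eqP.
have Smu : S = mu *: \1%VF by apply/(eigenbasis_scalar b_basis Sb).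
have mu0 : mu != 0 by apply: contraNneq S0 => mu0; rewrite Smu mu0 scale0r.
split; last by exists mu.
exists (mu^-1 *: \1)%VF => v.
  by rewrite -/S Smu !scale_lfunE !id_lfunE scalerA mulVf // scale1r.
by rewrite -/S Smu !scale_lfunE !id_lfunE scalerA mulfV // scale1r.
Qed.

End FrameEnergy.

Lemma functional_pow_vector_pow (K : fieldType) (X : vectType K) (m : nat)
    (f : 'Hom(X, K^o)) (v : X) :
  functional_pow m f (vector_pow m v) = f v ^+ m.
Proof.
rewrite functional_powE pure_tensorE /=.
under eq_bigr do rewrite ffunE.
by rewrite prodr_const card_ord.
Qed.

(** * From the energy to maxima of off-diagonal entries *)

Section OffDiagonal.
Variables (K : numFieldType) (n m : nat) (G : 'I_n -> 'I_n -> K).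

Let max_prod :=
  \big[Num.max/0]_(p : 'I_n * 'I_n | p.1 != p.2)
    `|G p.1 p.2 * G p.2 p.1| ^+ m.
Let max_one :=
  \big[Num.max/0]_(p : 'I_n * 'I_n | p.1 != p.2) `|G p.1 p.2| ^+ m.

Lemma max_off_diagonal_ge (c : K) : (1 < n)%N ->
  0 <= c -> c <= \sum_j \sum_k G j k ^+ m * G k j ^+ m ->
  (c - \sum_j `|G j j| ^+ (2 * m)) / (n%:R ^+ 2 - n%:R) <= max_prod.
Proof.
move=> n1 c0 cE.
have n_gt0 : 0 < n%:R ^+ 2 - n%:R :> K.
  rewrite expr2 -[X in _ - X]mulr1 -mulrBr pmulr_rgt0 ?ltr0n 1?ltnW //.
  by rewrite subr_gt0 ltr1n.
rewrite ler_pdivrMr // lerBlDl.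
(* A nonnegative energy equals its norm, so the triangle inequality applies even when individual
   terms are complex. *)
have energy_ge0 := le_trans c0 cE.
apply: (le_trans cE); rewrite -[leLHS]ger0_norm //.
under eq_bigr => j _ do rewrite (bigD1 j) //=.
rewrite big_split /=; apply: (le_trans (ler_normD _ _)); apply: lerD.
  apply: (le_trans (ler_norm_sum _ _ _)); apply: ler_sum => j _.
  by rewrite -exprD addnn -mul2n normrX.
(* The factor counts [n] rows of [n - 1] off-diagonal positions, so the comparison can be made term
   by term. *)
have -> : max_prod * (n%:R ^+ 2 - n%:R) =
    \sum_(j < n) \sum_(k < n | k != j) max_prod.
  under eq_bigr do rewrite sumr_const cardC1 card_ord.
  rewrite sumr_const card_ord -mulrnA -[RHS]mulr_natr natrM -subn1.
  by rewrite natrB 1?ltnW //; ring.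
apply: (le_trans (ler_norm_sum _ _ _)); apply: ler_sum => j _.
apply: (le_trans (ler_norm_sum _ _ _)); apply: ler_sum => k kj.
rewrite -exprMn normrX.
have F_ge0 (p : 'I_n * 'I_n) :
    p.1 != p.2 -> 0 <= `|G p.1 p.2 * G p.2 p.1| ^+ m.
  by move=> _; rewrite exprn_ge0.
by apply: (le_bigmax_nneg F_ge0 (i := (j, k)));
  rewrite ?mem_index_enum //= eq_sym.
Qed.

(** The positions [p] and [(p.2, p.1)] are both off-diagonal, so each factor is at most [max_one];
    this turns bounds on products into square-root bounds. *)
Lemma max_prod_le_sqr : max_prod <= max_one ^+ 2.
Proof.
have F_ge0 (p : 'I_n * 'I_n) : p.1 != p.2 -> 0 <= `|G p.1 p.2| ^+ m.
  by move=> _; rewrite exprn_ge0.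
rewrite /max_prod; elim/big_ind: _ => [|x y xM yM|p pP].
- by apply/exprn_ge0/bigmax_ge0.
- by rewrite /Num.max; case: ifP.
- rewrite normrM exprMn expr2; apply: ler_pM; rewrite ?exprn_ge0 //.
    by apply: (le_bigmax_nneg F_ge0); rewrite ?mem_index_enum.
  by apply: (le_bigmax_nneg F_ge0 (i := (p.2, p.1)));
    rewrite ?mem_index_enum //= eq_sym.
Qed.

End OffDiagonal.

(** * The higher-order Welch bounds and their normalized form *)

Lemma bin_multiset_gt0 (d m : nat) : (0 < d)%N -> (0 < 'C((d + m - 1)%N, m))%N.
Proof. by case: d => // d _; rewrite bin_gt0 addSn subn1 leq_addl. Qed.

Lemma welch_bound_factorE (K : fieldType) (N B : K) :
  B != 0 -> N != 0 -> N - 1 != 0 ->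
  (B^-1 * N ^+ 2 - N) / (N ^+ 2 - N) = (N - B) / (B * (N - 1)).
Proof.
move=> B0 N0 N1; rewrite -[X in _ / (_ - X)]mulr1 expr2 -mulrBr.
by field; rewrite B0 N0 N1.
Qed.

Lemma welch_bound_splitE (K : fieldType) (N B : K) :
  B != 0 -> N - 1 != 0 ->
  (N - B) / (B * (N - 1)) = (N - 1)^-1 * (N / B - 1).
Proof. by move=> B0 N1; field; rewrite B0 N1. Qed.

Theorem theorem2p7 (R : realType) (F : scalar_kind)
    (X : finBanachType (scalars R F)) (d n m : nat)
    (tau : 'I_n -> X) (f : 'I_n -> 'Hom(X, (scalars R F)^o))
    (dimX : \dim {:X} = d)
    (f_continuous : forall j, continuous (f j : X -> (scalars R F)^o))
    (le_dn : (d <= n)%N) :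
  let K : numFieldType := scalars R F in
  let fm := fun j => functional_pow m (f j) in
  let taum := fun j => vector_pow m (tau j) in
  let S : 'End(SymPow m X) := frame_operator fm taum in
  let G := fun j k : 'I_n => f j (tau k) : K in
  let B : K := 'C((d + m - 1)%N, m)%:R in
  let D : K := (\dim {: SymPow m X})%:R in
  let N : K := n%:R in
  let trace := \sum_(j < n) G j j ^+ m in
  let energy := \sum_(j < n) \sum_(k < n) G j k ^+ m * G k j ^+ m in
  let diag := \sum_(j < n) `|G j j| ^+ (2 * m) in
  let max_prod :=
    \big[Num.max/0]_(p : 'I_n * 'I_n | p.1 != p.2)
      `|G p.1 p.2 * G p.2 p.1| ^+ m in
  let max_one :=
    \big[Num.max/0]_(p : 'I_n * 'I_n | p.1 != p.2) `|G p.1 p.2| ^+ m in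
  diagonalizable_endo S ->
  (forall a : K, passmx.leigenvalue S a -> 0 <= a) ->
  [/\ [/\ \sum_(p : 'I_n * 'I_n) G p.1 p.2 ^+ m * G p.2 p.1 ^+ m = energy,
          energy >= B^-1 * trace ^+ 2
        & B^-1 * trace ^+ 2 = D^-1 * trace ^+ 2],
      (1 < n)%N ->
      max_prod >= (B^-1 * trace ^+ 2 - diag) / (N ^+ 2 - N) /\
      (B^-1 * trace ^+ 2 - diag) / (N ^+ 2 - N) =
        (D^-1 * trace ^+ 2 - diag) / (N ^+ 2 - N),
      (1 < n)%N ->
      max_one >= sqrt_scalar ((B^-1 * trace ^+ 2 - diag) / (N ^+ 2 - N)) /\
      sqrt_scalar ((B^-1 * trace ^+ 2 - diag) / (N ^+ 2 - N)) =
        sqrt_scalar ((D^-1 * trace ^+ 2 - diag) / (N ^+ 2 - N)),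
      S != 0 ->
      (energy = B^-1 * trace ^+ 2 <-> tight_ASF fm taum)
    & (1 < n)%N -> (forall j, f j (tau j) = 1) ->
      [/\ max_prod >= (N - B) / (B * (N - 1)),
          (N - B) / (B * (N - 1)) = (N - D) / (D * (N - 1))
        & (N - D) / (D * (N - 1)) = (N - 1)^-1 * (N / B - 1)] /\
      [/\ max_one >= sqrt_scalar ((N - B) / (B * (N - 1))),
          sqrt_scalar ((N - B) / (B * (N - 1))) =
            sqrt_scalar ((N - D) / (D * (N - 1)))
        & sqrt_scalar ((N - D) / (D * (N - 1))) =
            sqrt_scalar ((N - 1)^-1 * (N / B - 1))]].
Proof.
move=> K fm taum S G B D N trace energy diag max_prod max_one S_diag S_ge0.
have BD : B = D by rewrite /B /D dim_SymPow dimX.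
have fmE j k : fm j (taum k) = G j k ^+ m.
  exact: functional_pow_vector_pow.
have traceE : \sum_j fm j (taum j) = trace.
  by apply: eq_bigr => j _; rewrite fmE.
have energyE : \sum_j \sum_k fm j (taum k) * fm k (taum j) = energy.
  by apply: eq_bigr => j _; apply: eq_bigr => k _; rewrite !fmE.
have [trace_ge0 energy_ge] := frame_energy_ge S_diag S_ge0.
have tight := frame_energy_tight S_diag S_ge0.
rewrite traceE energyE -/D in trace_ge0 energy_ge tight.
have prod_ge : (1 < n)%N ->
    (B^-1 * trace ^+ 2 - diag) / (N ^+ 2 - N) <= max_prod.
  move=> n1; apply: max_off_diagonal_ge => //; rewrite BD //.
  by rewrite mulr_ge0 ?invr_ge0 ?exprn_ge0 // ler0n.
have one_ge (x : K) : x <= max_prod -> sqrt_scalar x <= max_one.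
  move=> x_le; apply: sqrt_scalar_le.
    exact: le_trans x_le (max_prod_le_sqr m G).
  by apply: bigmax_ge0 => p _; rewrite exprn_ge0.
split.
- split; [by rewrite /energy pair_big|by rewrite BD|by rewrite BD].
- by move=> n1; rewrite -BD; split=> //; apply: prod_ge.
- by move=> n1; rewrite -BD; split=> //; apply/one_ge/prod_ge.
- by move=> S0; rewrite BD; apply: tight.
move=> n1 f1.
(* In dimension 0 every [tau j] is 0, contradicting [f j (tau j) = 1]; positivity of [d] makes the
   binomial invertible. *)
have d_gt0 : (0 < d)%N.
  rewrite lt0n; apply/eqP => d0.
  have := f1 (Ordinal (ltnW n1)).
  have /eqP := dimX; rewrite d0 dimv_eq0 => /eqP X0.
  have := memvf (tau (Ordinal (ltnW n1))); rewrite X0 memv0 => /eqP ->.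
  by rewrite linear0 => /eqP; rewrite eq_sym oner_eq0.
have B0 : B != 0 by rewrite pnatr_eq0 -lt0n bin_multiset_gt0.
have N0 : N != 0 by rewrite pnatr_eq0 -lt0n ltnW.
have N1 : N - 1 != 0 by rewrite subr_eq0 pnatr_eq1 gtn_eqF.
have traceN : trace = N.
  rewrite /trace; under eq_bigr do rewrite /G f1 expr1n.
  by rewrite sumr_const card_ord.
have diagN : diag = N.
  rewrite /diag; under eq_bigr do rewrite /G f1 normr1 expr1n.
  by rewrite sumr_const card_ord.
have boundE : (B^-1 * trace ^+ 2 - diag) / (N ^+ 2 - N) =
    (N - B) / (B * (N - 1)).
  by rewrite traceN diagN welch_bound_factorE.
have boundE' : (N - B) / (B * (N - 1)) = (N - 1)^-1 * (N / B - 1).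
  exact: welch_bound_splitE.
have {}prod_ge := prod_ge n1.
rewrite boundE in prod_ge.
by rewrite -BD -boundE'; do !split=> //; apply: one_ge.
Qed.
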